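(* The category $\mathbf{QPZLC}$ of all zero-dimensional locally compact Hausdorff spaces and all quasi-open perfect maps between them is dually equivalent to the category $\mathbf{QGBPL}$ whose objects are all generalized Boolean pseudolattices and whose morphisms are all $\mathbf{GBPL}$-morphisms which preserve all meets that happen to exist.
   Context: A space is zero-dimensional if its clopen subsets form a base. A perfect map is a continuous closed map with compact fibres. A map $f:X\to Y$ is quasi-open if $\mathrm{int}(f(U))\neq\emptyset$ for every non-empty open $U\subseteq X$. A pseudolattice is a poset having all finite non-empty meets and joins; a $\{0\}$-pseudolattice is a pseudolattice with a least element $0$. A distributive $\{0\}$-pseudolattice $A$ is a generalized Boolean pseudolattice if for all $a,b,c\in A$ with $b\le a\le c$ there exists $x\in A$ with $a\wedge x=b$ and $a\vee x=c$. A $\{0\}$-pseudolattice homomorphism preserves $0$ and binary meets and joins. The category $\mathbf{GBPL}$ has all generalized Boolean pseudolattices as objects; its morphisms $\varphi:I\to J$ are all $\{0\}$-pseudolattice homomorphisms such that for every $b\in J$ there exists $a\in I$ with $b\le\varphi(a)$. ''Preserves all meets that happen to exist'' means: if a family $\{a_i\}$ in $I$ has a meet $a$ in $I$, then $\{\varphi(a_i)\}$ has a meet in $J$, equal to $\varphi(a)$. Two categories are dually equivalent if one is equivalent to the opposite of the other. *)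

(* Defs.v *)
From mathcomp Require Import all_boot all_order.
From mathcomp Require Import mathcomp_extra boolp classical_sets topology.

Set Implicit Arguments.
Unset Strict Implicit.
Unset Printing Implicit Defensive.

Import Order.TTheory.
Local Open Scope classical_set_scope.

Record category := Category {
  obj :> Type;
  hom : obj -> obj -> Type;
  idc : forall X, hom X X;
  compc : forall X Y Z, hom Y Z -> hom X Y -> hom X Z;
  compc1 : forall X Y (f : hom X Y), compc f (idc X) = f;
  comp1c : forall X Y (f : hom X Y), compc (idc Y) f = f;
  compcA : forall X Y Z W (h : hom Z W) (g : hom Y Z) (f : hom X Y),
    compc h (compc g f) = compc (compc h g) f }.

Arguments hom {c} X Y.
Arguments idc {c} X.
Arguments compc {c X Y Z} g f.

Definition opposite (C : category) : category :=
  @Category C (fun X Y => hom Y X) (fun X => idc X)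
    (fun X Y Z g f => compc f g)
    (fun X Y f => comp1c f) (fun X Y f => compc1 f)
    (fun X Y Z W h g f => esym (compcA f g h)).

Record functor (C D : category) := Functor {
  fobj :> C -> D;
  fhom : forall X Y : C, hom X Y -> hom (fobj X) (fobj Y);
  fhom1 : forall X : C, fhom (idc X) = idc (fobj X);
  fhomM : forall (X Y Z : C) (g : hom Y Z) (f : hom X Y),
    fhom (compc g f) = compc (fhom g) (fhom f) }.

Arguments fhom {C D} F {X Y} f : rename.

Definition id_functor (C : category) : functor C C :=
  @Functor C C id (fun X Y f => f) (fun X => erefl) (fun X Y Z g f => erefl).

Section FunctorComposition.
Variables (C D E : category) (G : functor D E) (F : functor C D).

Lemma comp_functor1 (X : C) : fhom G (fhom F (idc X)) = idc (G (F X)).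
Proof. by rewrite !fhom1. Qed.

Lemma comp_functorM (X Y Z : C) (g : hom Y Z) (f : hom X Y) :
  fhom G (fhom F (compc g f)) =
  compc (fhom G (fhom F g)) (fhom G (fhom F f)).
Proof. by rewrite !fhomM. Qed.

Definition comp_functor : functor C E :=
  @Functor C E (fun X => G (F X)) (fun X Y f => fhom G (fhom F f))
    comp_functor1 comp_functorM.

End FunctorComposition.

Definition naturally_isomorphic (C D : category) (F G : functor C D) : Prop :=
  exists (eta : forall X : C, hom (F X) (G X))
         (eps : forall X : C, hom (G X) (F X)),
  [/\ forall (X Y : C) (f : hom X Y),
        compc (fhom G f) (eta X) = compc (eta Y) (fhom F f),
      forall X : C, compc (eps X) (eta X) = idc (F X)
    & forall X : C, compc (eta X) (eps X) = idc (G X)].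

Definition equivalent (C D : category) : Prop :=
  exists (F : functor C D) (G : functor D C),
    naturally_isomorphic (comp_functor G F) (id_functor C) /\
    naturally_isomorphic (comp_functor F G) (id_functor D).

Definition dually_equivalent (C D : category) : Prop :=
  equivalent C (opposite D).

Section ConcreteCategory.
Variables (O : Type) (carrier : O -> Type).
Variable P : forall X Y : O, (carrier X -> carrier Y) -> Prop.
Hypothesis P_id : forall X : O, P (@id (carrier X)).
Hypothesis P_comp : forall (X Y Z : O)
  (g : carrier Y -> carrier Z) (f : carrier X -> carrier Y),
  P g -> P f -> P (g \o f).

Let chom (X Y : O) := {f : carrier X -> carrier Y | P f}.

Let cid (X : O) : chom X X := exist _ id (P_id X).

Let ccomp (X Y Z : O) (g : chom Y Z) (f : chom X Y) : chom X Z :=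
  exist _ (sval g \o sval f) (P_comp (svalP g) (svalP f)).

Let chom_eq (X Y : O) (f g : chom X Y) : sval f = sval g -> f = g.
Proof.
case: f g => [f fP] [g gP] /= fg; rewrite {}fg in fP *.
by rewrite (Prop_irrelevance fP gP).
Qed.

Definition concrete_category : category.
Proof.
refine (@Category O chom cid ccomp _ _ _).
- by move=> X Y f; exact: chom_eq.
- by move=> X Y f; exact: chom_eq.
- by move=> X Y Z W h g f; exact: chom_eq.
Defined.

End ConcreteCategory.

(* [topology.zero_dimensional] only asks that distinct points be separated by
   clopen sets, so the base condition is spelled out with [basis] instead. *)
Record zlc := ZLC {
  zlc_sort :> topologicalType;
  zlc_clopen_basis : basis (@clopen zlc_sort);
  zlc_locally_compact : locally_compact [set: zlc_sort];
  zlc_hausdorff : hausdorff_space zlc_sort }.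

Section Maps.
Variables X Y : topologicalType.
Implicit Type f : X -> Y.

Definition closed_map f := forall A : set X, closed A -> closed (f @` A).

Definition perfect_map f :=
  [/\ continuous f, closed_map f & forall y : Y, compact (f @^-1` [set y])].

Definition quasi_open f :=
  forall U : set X, open U -> U !=set0 -> interior (f @` U) !=set0.

End Maps.

Lemma perfect_map_preimage_compact (X Y : topologicalType) (f : X -> Y)
  (K : set Y) : perfect_map f -> compact K -> compact (f @^-1` K).
Proof.
move=> [_ fcl fK] cK F PF FK.
have [y [Ky yF]] := cK (f @ F) _ FK.
have fib A : F A -> (f @^-1` [set y] `&` closure A) !=set0.
  move=> FA; have : (f @` closure A) y.
    apply: (fcl _ (@closed_closure _ A)).
    move=> V Vy.
    have FfA : F (f @^-1` (f @` A)) by apply: (filterS _ FA) => x Ax; exists x.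
    have [_ [[x Ax <-] Vx]] := yF _ _ FfA Vy.
    by exists (f x); split=> //; exists x => //; exact: subset_closure.
  by move=> [x clAx fxy]; exists x.
pose H := filter_from F (fun A => f @^-1` [set y] `&` closure A).
have PH : ProperFilter H.
  apply: filter_from_proper; last by move=> A; exact: fib.
  apply: filter_from_filter; first by exists setT; exact: filterT.
  move=> A B FA FB; exists (A `&` B); first exact: filterI.
  by move=> x [fx clx]; split; split=> //; apply: closureS clx => z [].
have Hfib : H (f @^-1` [set y]) by exists setT; [exact: filterT|move=> x []].
have [x [fxy xH]] := fK y H PH Hfib.
exists x; split; first by rewrite /preimage /= fxy.
move=> A B FA Bx.
have /closed_closure clAx : closure (closure A) x.
  by move=> V Vx; apply: (xH _ _ _ Vx); exists A => // z [].
exact: clAx.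
Qed.

Definition quasi_open_perfect (X Y : zlc) (f : X -> Y) :=
  perfect_map f /\ quasi_open f.

Lemma quasi_open_perfect_id (X : zlc) : @quasi_open_perfect X X id.
Proof.
split; first split.
- by move=> x; exact: cvg_id.
- by move=> A; rewrite image_id.
- by move=> x; exact: compact_set1.
- by move=> U oU; rewrite image_id => -[x Ux]; exists x; exact: open_nbhs_nbhs.
Qed.

Lemma quasi_open_perfect_comp (X Y Z : zlc) (g : Y -> Z) (f : X -> Y) :
  quasi_open_perfect g -> quasi_open_perfect f -> quasi_open_perfect (g \o f).
Proof.
move=> [gp gq] [fp fq]; have [gc gcl gK] := gp; have [fc fcl fK] := fp.
split; first split.
- by move=> x; apply: continuous_comp; [exact: fc|exact: gc].
- by move=> A cA; rewrite -image_comp; apply/gcl/fcl.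
- move=> z; rewrite comp_preimage.
  exact: perfect_map_preimage_compact.
- move=> U oU U0; have fU0 := fq _ oU U0.
  have [z gz] := gq _ (@open_interior _ (f @` U)) fU0.
  exists z; rewrite -image_comp; apply: interiorS gz.
  exact: image_subset (@interior_subset _ _).
Qed.

Definition QPZLC : category :=
  concrete_category quasi_open_perfect_id quasi_open_perfect_comp.

Local Open Scope order_scope.

Record gbpl := GBPL {
  gbpl_disp : Order.disp_t;
  gbpl_sort :> bDistrLatticeType gbpl_disp;
  gbpl_complement : forall a b c : gbpl_sort, b <= a -> a <= c ->
    exists x : gbpl_sort, a `&` x = b /\ a `|` x = c }.

(* The library's [{blmorphism I -> J}] only preserves the bottom element, hence
   the explicit conjunction. *)
Definition pseudolattice0_morphism (I J : gbpl) (phi : I -> J) :=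
  [/\ phi \bot = \bot, Order.meet_morphism phi & Order.join_morphism phi].

Definition gbpl_morphism (I J : gbpl) (phi : I -> J) :=
  pseudolattice0_morphism phi /\ forall b : J, exists a : I, b <= phi a.

Definition preserves_existing_meets (I J : gbpl) (phi : I -> J) :=
  forall (K : Type) (s : K -> I) (a : I),
    infimums (range s) a -> infimums (range (phi \o s)) (phi a).

Definition qgbpl_morphism (I J : gbpl) (phi : I -> J) :=
  gbpl_morphism phi /\ preserves_existing_meets phi.

Lemma qgbpl_morphism_id (I : gbpl) : @qgbpl_morphism I I id.
Proof. by split=> //; split=> // b; exists b. Qed.

Lemma qgbpl_morphism_comp (I J L : gbpl) (psi : J -> L) (phi : I -> J) :
  qgbpl_morphism psi -> qgbpl_morphism phi -> qgbpl_morphism (psi \o phi).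
Proof.
move=> [[[psi0 psiI psiU] psic] psim] [[[phi0 phiI phiU] phic] phim].
split; last by move=> K s a /phim/psim.
split; first by split=> [|x y|x y] /=;
  rewrite ?phi0 ?phiI ?phiU ?psi0 ?psiI ?psiU.
move=> c; have [b cb] := psic c; have [a ba] := phic b; exists a.
apply: le_trans cb _; rewrite -(meet_idPl ba) psiI.
exact: leIr.
Qed.

Definition QGBPL : category :=
  concrete_category qgbpl_morphism_id qgbpl_morphism_comp.

(* Main.v *)
From HB Require Import structures.
From mathcomp Require Import all_boot all_order.
From mathcomp Require Import mathcomp_extra boolp classical_sets topology.
Require Import Defs.

Set Implicit Arguments.
Unset Strict Implicit.
Unset Printing Implicit Defensive.

Import Order.TTheory.
Local Open Scope classical_set_scope.

(** This is Stone duality for generalized Boolean pseudolattices, restricted to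
    matching classes of morphisms on its two sides. A space X is sent to the
    lattice of its compact clopen sets, and a map to its preimage operator; the
    theorem holds because this contravariant functor is fully faithful and
    essentially surjective ([equivalent_fully_faithful]).

    Over a zero-dimensional locally compact Hausdorff space the compact clopen
    sets form a base, so they separate points and determine continuous maps:
    the functor is faithful. By compactness, every prime filter of compact
    clopen sets consists of the sets through a single point
    ([prime_filter_point]). Given a morphism phi : CK(Y) -> CK(X) and a point x,
    the sets A with x in phi(A) form such a filter (cofinality of phi makes it
    nonempty), and x is sent to the point of Y that it determines. The
    preimage operator of the resulting map f is phi, and f is perfect because
    preimages of compact clopen sets are compact.

    Quasi-openness corresponds to preservation of meets. Suppose first that f is
    quasi-open, that a is the meet of a family (s_k), and that some compact
    clopen C lies in every f^-1(s_k) but not in f^-1(a). Then the image of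
    C \ f^-1(a) contains a nonempty compact clopen set, which lies in every s_k
    but misses a ([cc_preimage_qgbpl]). Conversely, if the image f(B) of a
    nonempty compact clopen B had empty interior, the compact clopen sets
    containing f(B) would have the empty set as their meet, while their
    preimages all contain B ([point_map_quasi_open]).

    For essential surjectivity, a lattice I is recovered from the space of its
    prime filters, topologized by the sets {p | a in p}. Zorn's lemma provides
    enough prime filters to tell the elements of I apart
    ([prime_filter_separation]). A basic set is compact because an ultrafilter
    F on the space converges to the prime filter of those b whose basic set is
    in F ([compact_basic_set]). Hence the basic sets are precisely the compact
    clopen sets, and they form a copy of I. *)

(** * Equivalences from fully faithful, essentially surjective functors *)

(** The inverse functor is obtained by choosing, for each Y, an X with an
    isomorphism u between F X and Y, and by conjugating with these
    isomorphisms; the lifts along F exist by fullness, and all the equations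
    are checked after applying F, by faithfulness. *)
Lemma equivalent_fully_faithful (C D : category) (F : functor C D) :
    (forall (X Y : C) (f g : hom X Y), fhom F f = fhom F g -> f = g) ->
    (forall (X Y : C) (g : hom (F X) (F Y)), exists f, fhom F f = g) ->
    (forall Y : D, exists (X : C) (u : hom (F X) Y) (v : hom Y (F X)),
       compc v u = idc (F X) /\ compc u v = idc Y) ->
  equivalent C D.
Proof.
move=> faithful /(_ _ _ _)/cid lift_ex ess.
pose lift (X Y : C) (g : hom (F X) (F Y)) : hom X Y := sval (lift_ex X Y g).
have liftK (X Y : C) (g : hom (F X) (F Y)) : fhom F (lift X Y g) = g.
  exact: svalP (lift_ex X Y g).
pose G0 Y : C := sval (cid (ess Y)).
pose u Y : hom (F (G0 Y)) Y := sval (cid (svalP (cid (ess Y)))).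
pose v Y : hom Y (F (G0 Y)) := sval (cid (svalP (cid (svalP (cid (ess Y)))))).
have vu Y : compc (v Y) (u Y) = idc _.
  by case: (svalP (cid (svalP (cid (svalP (cid (ess Y))))))).
have uv Y : compc (u Y) (v Y) = idc _.
  by case: (svalP (cid (svalP (cid (svalP (cid (ess Y))))))).
pose G1 (Y Z : D) (h : hom Y Z) := lift _ _ (compc (v Z) (compc h (u Y))).
have G11 Y : G1 Y Y (idc Y) = idc (G0 Y).
  by apply: faithful; rewrite liftK fhom1 comp1c vu.
have G1M (X Y Z : D) (g : hom Y Z) (f : hom X Y) :
    G1 X Z (compc g f) = compc (G1 Y Z g) (G1 X Y f).
  apply: faithful; rewrite fhomM !liftK -!compcA; congr compc.
  by rewrite (compcA (u Y)) uv comp1c.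
pose G := Functor G11 G1M.
exists F, G; split.
- exists (fun X => lift (G (F X)) X (u (F X))), (fun X => lift _ _ (v (F X))).
  split=> [X Y f|X|X] /=; apply: faithful;
    rewrite !fhomM ?fhom1 !liftK ?uv ?vu //.
  by rewrite compcA uv comp1c.
- exists u, v; split=> // X Y f /=.
  by rewrite liftK compcA uv comp1c.
Qed.

(** * The lattice of compact clopen sets *)

(** Lets bundled sets be applied to points, as in [A x]. *)
Identity Coercion set_to_predicate : set >-> Funclass.

Record compact_clopen (X : topologicalType) := CompactClopen {
  compact_clopen_set :> set X;
  compact_clopen_clopen : clopen compact_clopen_set;
  compact_clopen_compact : compact compact_clopen_set }.

Section CompactClopenLattice.
Variable X : topologicalType.
Implicit Types A B C : compact_clopen X.

Lemma compact_clopen_eq A B : A = B :> set X -> A = B.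
Proof.
case: A B => [A cA kA] [B cB kB] /= AB; rewrite {}AB in cA kA *.
by rewrite (Prop_irrelevance cA cB) (Prop_irrelevance kA kB).
Qed.

Lemma clopenD (A B : set X) : clopen A -> clopen B -> clopen (A `\` B).
Proof. by move=> cA cB; rewrite setDE; apply/clopenI/clopenC. Qed.

Lemma compact_clopen_sub A (S : set X) : clopen S -> S `<=` A -> compact S.
Proof.
by move=> [_ ?]; apply: subclosed_compact => //; exact: compact_clopen_compact.
Qed.

Definition cc0 : compact_clopen X :=
  CompactClopen (conj open0 closed0) (@compact0 X).

Definition ccI A B : compact_clopen X :=
  let c := clopenI (compact_clopen_clopen A) (compact_clopen_clopen B) in
  CompactClopen c (compact_clopen_sub c (@subIsetl _ A B)).

Definition ccU A B : compact_clopen X :=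
  CompactClopen (clopenU (compact_clopen_clopen A) (compact_clopen_clopen B))
    (compactU (@compact_clopen_compact _ A) (@compact_clopen_compact _ B)).

Definition ccD A B : compact_clopen X :=
  let c := clopenD (compact_clopen_clopen A) (compact_clopen_clopen B) in
  CompactClopen c (compact_clopen_sub c (@subDsetl _ A B)).

Definition cc_le A B := `[< A `<=` B >].

HB.instance Definition _ := gen_eqMixin (compact_clopen X).
HB.instance Definition _ := gen_choiceMixin (compact_clopen X).

Fact cc_display : Order.disp_t. Proof. exact: Order.Disp tt tt. Qed.

Fact cc_le_def A B : cc_le A B = (ccI A B == A).
Proof.
apply/asboolP/eqP => [AB|<-]; last exact: subIsetr.
by apply: compact_clopen_eq; apply/setIidPl.
Qed.

Fact ccIC : commutative ccI.
Proof. by move=> A B; apply/compact_clopen_eq/setIC. Qed.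
Fact ccUC : commutative ccU.
Proof. by move=> A B; apply/compact_clopen_eq/setUC. Qed.
Fact ccIA : associative ccI.
Proof. by move=> A B C; apply/compact_clopen_eq/setIA. Qed.
Fact ccUA : associative ccU.
Proof. by move=> A B C; apply/compact_clopen_eq/setUA. Qed.
Fact ccUKI B A : ccI A (ccU A B) = A.
Proof. by apply: compact_clopen_eq; rewrite /= setUC setKU. Qed.
Fact ccIKU B A : ccU A (ccI A B) = A.
Proof. by apply/compact_clopen_eq; rewrite /= setIC setKI. Qed.
Fact ccIUl : left_distributive ccI ccU.
Proof. by move=> A B C; apply/compact_clopen_eq/setIUl. Qed.
Fact ccIxx : idempotent_op ccI.
Proof. by move=> A; apply/compact_clopen_eq/setIid. Qed.

HB.instance Definition _ := Order.isMeetJoinDistrLattice.Build cc_display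
  (compact_clopen X) cc_le_def (fun _ _ => erefl) ccIC ccUC ccIA ccUA
  ccUKI ccIKU ccIUl ccIxx.

Fact cc_le0x A : (cc0 <= A)%O.
Proof. by apply/asboolP => x. Qed.

HB.instance Definition _ := Order.hasBottom.Build cc_display
  (compact_clopen X) cc_le0x.

Lemma cc_leP A B : reflect (A `<=` B) (A <= B)%O.
Proof. exact: asboolP. Qed.

Lemma cc_complement A B C : (B <= A)%O -> (A <= C)%O ->
  exists x : compact_clopen X, (A `&` x = B /\ A `|` x = C)%O.
Proof.
move=> /cc_leP BA /cc_leP AC; exists (ccU B (ccD C A)); split.
- apply: compact_clopen_eq => /=; rewrite setIUr (iffRL (setIidPr _ _) BA).
  by rewrite setDE setICA setICr setI0 setU0.
- apply: compact_clopen_eq => /=; rewrite setUA (@setUidl _ A B BA).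
  by rewrite setDUK.
Qed.

End CompactClopenLattice.

Definition compact_clopen_gbpl (X : topologicalType) : gbpl :=
  GBPL (@cc_complement X).

(** * Compact clopen sets in zero-dimensional locally compact spaces *)

(** If no member of the cover contained [K], the traces on [K] of the
    complements of the members would be nonempty and closed under finite
    intersections, hence would generate a filter without cluster point in
    [K]. *)
Lemma compact_directed_cover (T : topologicalType) (K : set T)
    (P : set (set T)) :
    compact K -> P set0 -> (forall U V, P U -> P V -> P (U `|` V)) ->
    (forall x, K x -> exists U, [/\ P U, open U & U x]) ->
  exists2 U, P U & K `<=` U.
Proof.
move=> kK P0 PU cover; apply: contrapT => noU.
pose F := filter_from P (fun U => K `\` U).
have PF : ProperFilter F.
  apply: filter_from_proper.
    apply: filter_from_filter; first by exists set0.
    move=> U V PU' PV; exists (U `|` V); first exact: PU.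
    by move=> x [Kx nUV]; split; split=> // ?; apply: nUV; [left|right].
  move=> U PU'; apply: contrapT => KU0; apply: noU; exists U => // x Kx.
  by apply: contrapT => nUx; apply: KU0; exists x.
have [|x [Kx Fx]] := kK F PF; first by exists set0 => // x [].
have [U [PU' oU Ux]] := cover x Kx.
have FU : F (K `\` U) by exists U.
by have [y [[_ nUy] Uy]] := Fx _ _ FU (open_nbhs_nbhs (conj oU Ux)).
Qed.

Lemma zlc_closed_set1 (X : zlc) (x : X) : closed [set x].
Proof.
apply: accessible_closed_set1; apply: hausdorff_accessible.
exact: zlc_hausdorff.
Qed.

Lemma compact_clopen_nbhs (X : zlc) (x : X) (U : set X) : nbhs x U ->
  exists A : compact_clopen X, A x /\ A `<=` U.
Proof.
move=> Ux; have [K Kx [kK _]] := zlc_locally_compact (x := x) I.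
have {}Kx : nbhs x K.
  by apply: filterS (Kx : nbhs x [set y | setT y -> K y]) => y; apply.
have UK : nbhs x (U `&` K) by exact: filterI.
have [V [cV Vx] VUK] := (zlc_clopen_basis X).2 x _ UK.
have kV : compact V.
  by apply: (subclosed_compact cV.2 kK) => y /VUK [].
by exists (CompactClopen cV kV); split=> // y /VUK [].
Qed.

Lemma compact_sub_compact_clopen (X : zlc) (K : set X) : compact K ->
  exists A : compact_clopen X, K `<=` A.
Proof.
move=> kK.
have [||x _|U [A UA] KU] := @compact_directed_cover _ _
    [set U | exists A : compact_clopen X, U `<=` A] kK.
- by exists (cc0 X).
- move=> U V [A UA] [B VB]; exists (ccU A B) => x [/UA|/VB]; [by left|by right].
- have [A [Ax _]] := compact_clopen_nbhs (@filterT _ (nbhs x) _).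
  by exists A; split=> //; [exists A|case: (compact_clopen_clopen A)].
- by exists A; apply: subset_trans UA.
Qed.

(** * Prime filters of distributive lattices *)

Section PrimeFilters.
Local Open Scope order_scope.

Record prime_filter (d : Order.disp_t) (I : bDistrLatticeType d) :=
  PrimeFilter {
  prime_filter_set :> set I;
  prime_filter0 : ~ prime_filter_set \bot;
  prime_filterI : forall a b,
    prime_filter_set (a `&` b) <-> prime_filter_set a /\ prime_filter_set b;
  prime_filterU : forall a b,
    prime_filter_set (a `|` b) <-> prime_filter_set a \/ prime_filter_set b;
  prime_filter_ex : exists a, prime_filter_set a }.

Lemma prime_filter_eq (d : Order.disp_t) (I : bDistrLatticeType d)
  (p q : prime_filter I) : (forall a, p a <-> q a) -> p = q.
Proof.
move=> /predeqP; case: p q => [p p0 pI pU px] [q q0 qI qU qx] /= pq.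
rewrite {}pq in p0 pI pU px *.
by congr PrimeFilter; exact: Prop_irrelevance.
Qed.

Lemma prime_filter_le (d : Order.disp_t) (I : bDistrLatticeType d)
  (p : prime_filter I) a b : a <= b -> p a -> p b.
Proof. by move=> /meet_idPl <- /prime_filterI []. Qed.

(** A maximal filter containing [c] and avoiding [\bot] exists by Zorn's lemma.
    It contains every [x] meeting all its members ([ext] below), hence it is
    upward closed and prime. *)
Lemma prime_filter_exists (d : Order.disp_t) (I : bDistrLatticeType d) (c : I) :
  c != \bot -> exists p : prime_filter I, p c.
Proof.
move=> c0.
(* The empty set satisfies [P], so that empty chains need no separate
   treatment; a maximal solution is nonempty since [set c] is one. *)
pose P (S : set I) := S !=set0 ->
  [/\ S c, ~ S \bot & forall a b, S a -> S b -> S (a `&` b)].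
have [|M [PM Mmax]] := @Zorn_bigcup _ P.
  move=> F FP Ftot [x [X FX Xx]]; split.
  - by exists X => //; have [] := FP _ FX (ex_intro _ x Xx).
  - by move=> [A FA A0]; have [] := FP _ FA (ex_intro _ _ A0).
  - move=> a b [A FA Aa] [B FB Bb].
    have [AB|BA] := Ftot A B FA FB.
      exists B => //; have [_ _] := FP _ FB (ex_intro _ _ Bb).
      by apply => //; exact: AB.
    exists A => //; have [_ _] := FP _ FA (ex_intro _ _ Aa).
    by apply => //; exact: BA.
have maxE (S : set I) x : M `<=` S -> P S -> S x -> M x.
  move=> MS PS Sx; apply: contrapT => nMx; apply: (Mmax S) => //.
  by split=> // SM; apply/nMx/SM.
have Mc : M c.
  apply: contrapT => nMc; have M0 x : ~ M x.
    by move=> Mx; have [] := PM (ex_intro _ x Mx).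
  apply/nMc/(maxE [set c]) => [x /M0//|_|//].
  by split=> // [c0'|a b -> ->]; rewrite ?meetxx//; move/eqP: c0; apply.
have [_ nM0 MI] := PM (ex_intro _ c Mc).
have ext x : (forall m, M m -> m `&` x != \bot) -> M x.
  move=> Mx; apply: (maxE [set z | exists2 m, M m & m `&` x <= z]).
  - by move=> m Mm; exists m => //; exact: leIl.
  - move=> _; split.
    + by exists c => //; exact: leIl.
    + by move=> [m /Mx]; rewrite lex0 => /negP.
    + move=> a b [m Mm ma] [n Mn nb]; exists (m `&` n); first exact: MI.
      rewrite lexI (le_trans _ ma) ?(le_trans _ nb) //.
        by apply: leI2 => //; exact: leIr.
      by apply: leI2 => //; exact: leIl.
  - by exists c => //; exact: leIr.
have Mle a b : a <= b -> M a -> M b.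
  move=> ab Ma; apply: ext => m Mm; apply/eqP => mb; apply: nM0.
  suff <- : m `&` a = \bot by exact: MI.
  by apply/eqP; rewrite -lex0 -mb leI2.
have nM x : ~ M x -> exists2 m, M m & m `&` x = \bot.
  move=> nMx; apply: contrapT => H; apply/nMx/ext => m Mm.
  by apply/eqP => mx; apply: H; exists m.
have Mmeet a b : M (a `&` b) <-> M a /\ M b.
  split=> [Mab|[]]; last exact: MI.
  by split; apply: Mle Mab; [exact: leIl|exact: leIr].
have Mjoin a b : M (a `|` b) <-> M a \/ M b.
  split=> [Mab|[]]; last 2 first.
  + by apply: Mle; exact: leUl.
  + by apply: Mle; exact: leUr.
  apply: contrapT => /not_orP[/nM[m Mm ma] /nM[n Mn nb]]; apply: nM0.
  suff <- : (m `&` n) `&` (a `|` b) = \bot by apply: (MI) => //; exact: MI.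
  by rewrite meetUr meetAC ma meet0x -meetA nb meetx0 joinxx.
by exists (PrimeFilter nM0 Mmeet Mjoin (ex_intro _ c Mc)).
Qed.

(** * The space of prime filters *)

Section StoneSpace.
Variable I : gbpl.
Implicit Types (p q : prime_filter I) (a b : I).

Lemma relative_difference a b : exists x, b `&` x = \bot /\ b `|` x = b `|` a.
Proof. by apply: gbpl_complement; [exact: le0x|exact: leUl]. Qed.

(** If [a] is not below [b], a prime filter through the nonzero difference of
    [a] and [b] contains [a] but not [b]. *)
Lemma prime_filter_separation a b :
  (forall p, p a -> p b) -> a <= b.
Proof.
move=> ab; have [x [bx0 bxa]] := relative_difference a b.
have [x0|/prime_filter_exists [p px]] := eqVneq x \bot.
  by rewrite x0 joinx0 in bxa; rewrite bxa leUr.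
have pbx : p (b `|` x) by apply/prime_filterU; right.
have pb : p b by move: pbx; rewrite bxa => /prime_filterU[//|/ab].
by have := @prime_filter0 _ _ p; rewrite -bx0 => -[]; apply/prime_filterI.
Qed.

HB.instance Definition _ := gen_eqMixin (prime_filter I).
HB.instance Definition _ := gen_choiceMixin (prime_filter I).

Definition basic_set a : set (prime_filter I) := [set p | p a].

Definition basic_open (U : set (prime_filter I)) :=
  forall p, U p -> exists a, p a /\ basic_set a `<=` U.

Fact basic_openT : basic_open setT.
Proof. by move=> p _; have [a pa] := prime_filter_ex p; exists a. Qed.

Fact basic_openI : setI_closed basic_open.
Proof.
move=> U V oU oV p [/oU[a [pa aU]] /oV[b [pb bV]]]; exists (a `&` b).
split; first by apply/prime_filterI.
by move=> q /prime_filterI [/aU ? /bV].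
Qed.

Fact basic_open_bigU (J : Type) (f : J -> set (prime_filter I)) :
  (forall i, basic_open (f i)) -> basic_open (\bigcup_i f i).
Proof.
move=> of_ p [i _ /of_[a [pa af]]]; exists a; split=> // q /af ?.
by exists i.
Qed.

HB.instance Definition _ := isOpenTopological.Build (prime_filter I)
  basic_openT basic_openI basic_open_bigU.

Lemma basic_setI a b :
  basic_set (a `&` b) = (basic_set a `&` basic_set b)%classic.
Proof. by apply/predeqP => p; exact: prime_filterI. Qed.

Lemma basic_setU a b :
  basic_set (a `|` b) = (basic_set a `|` basic_set b)%classic.
Proof. by apply/predeqP => p; exact: prime_filterU. Qed.

Lemma basic_set0 : basic_set \bot = set0.
Proof. by apply/predeqP => p; split=> // /prime_filter0. Qed.

Lemma basic_open_open U : basic_open U -> open U.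
Proof. by []. Qed.

Lemma open_basic_set a : open (basic_set a).
Proof. by apply: basic_open_open => p pa; exists a; split. Qed.

Lemma basic_set_nbhs p a : p a -> nbhs p (basic_set a).
Proof.
by move=> pa; apply: open_nbhs_nbhs; split=> //; exact: open_basic_set.
Qed.

Lemma nbhs_basic_set p (U : set (prime_filter I)) :
  nbhs p U -> exists a, p a /\ basic_set a `<=` U.
Proof.
move=> [V [oV /oV [a [pa aV]] VU]]; exists a.
by split=> //; apply: subset_trans VU.
Qed.

(** If [p] misses [a] and contains [b], then it contains the difference of [b]
    and [a], whose basic set is disjoint from that of [a]. *)
Lemma closed_basic_set a : closed (basic_set a).
Proof.
rewrite -[basic_set a]setCK closedC; apply: basic_open_open => p npa.
have [b pb] := prime_filter_ex p.
have [x [ax0 axb]] := relative_difference b a.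
have : p (a `|` x) by rewrite axb; apply/prime_filterU; right.
move=> /prime_filterU[//|px]; exists x; split=> // q qx qa.
by apply: (@prime_filter0 _ _ q); rewrite -ax0; apply/prime_filterI.
Qed.

(** The limit of an ultrafilter [F] is [[set b | F (basic_set b)]], which is
    prime because an ultrafilter containing a union of two sets contains one of
    them. *)
Lemma compact_basic_set a : compact (basic_set a).
Proof.
rewrite compact_ultra => F UF Fa.
pose L := [set b | F (basic_set b)].
have L0 : ~ L \bot by rewrite /L /= basic_set0; exact: filter_not_empty.
have LI b c : L (b `&` c) <-> L b /\ L c.
  rewrite /L /= basic_setI; split=> [Fbc|[Fb Fc]]; last exact: filterI.
  by split; apply: filterS Fbc => p [].
have LU b c : L (b `|` c) <-> L b \/ L c.
  rewrite /L /= basic_setU; split=> [Fbc|[]]; last 2 first.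
  - by apply: filterS => p; left.
  - by apply: filterS => p; right.
  have [|Fnb] := in_ultra_setVsetC (basic_set b) UF; first by left.
  by right; apply: filterS (filterI Fbc Fnb) => p [[]].
exists (PrimeFilter L0 LI LU (ex_intro L a Fa)); split=> // U.
by move=> /nbhs_basic_set [b [Fb bU]]; apply: filterS bU Fb.
Qed.

Lemma clopen_basic_set a : clopen (basic_set a).
Proof. by split; [exact: open_basic_set|exact: closed_basic_set]. Qed.

Lemma prime_filter_clopen_basis : basis (@clopen (prime_filter I)).
Proof.
split=> [U []//|p U /nbhs_basic_set [a [pa aU]]].
by exists (basic_set a) => //; split=> //; exact: clopen_basic_set.
Qed.

Lemma prime_filter_locally_compact : locally_compact [set: prime_filter I].
Proof.
move=> p _; have [a pa] := prime_filter_ex p; exists (basic_set a).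
  by apply: filterS (basic_set_nbhs pa).
by split; [exact: compact_basic_set|exact: closed_basic_set].
Qed.

Lemma prime_filter_hausdorff : hausdorff_space (prime_filter I).
Proof.
move=> p q pq; apply: prime_filter_eq => a; split=> [pa|qa].
- by apply: closed_basic_set => U; apply: pq; exact: basic_set_nbhs.
- apply: contrapT => npa.
  have [oC _] := clopenC set0 (clopen_basic_set a).
  have [r []//] := pq _ _ (open_nbhs_nbhs (conj oC npa))
    (basic_set_nbhs qa).
Qed.

Definition stone_space : zlc := ZLC prime_filter_clopen_basis
  prime_filter_locally_compact prime_filter_hausdorff.

Definition stone_map a : compact_clopen stone_space :=
  CompactClopen (clopen_basic_set a : @clopen stone_space _)
    (@compact_basic_set a).

Lemma stone_map_le a b : (stone_map a <= stone_map b) = (a <= b).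
Proof.
apply/cc_leP/idP => [ab|ab p]; last exact: prime_filter_le.
by apply: prime_filter_separation => p; exact: ab.
Qed.

(** A compact open set is a finite union of basic sets, and these are closed
    under finite unions. *)
Lemma stone_map_surj (A : compact_clopen stone_space) :
  exists a, stone_map a = A.
Proof.
have [[oA _] kA] := (compact_clopen_clopen A, @compact_clopen_compact _ A).
have [|||_ [a -> aA] Aa] := @compact_directed_cover _ _
    [set U | exists2 a, U = basic_set a & basic_set a `<=` A]%classic kA.
- by exists \bot; rewrite ?basic_set0.
- move=> _ _ [a -> aA] [b -> bA]; exists (a `|` b); rewrite basic_setU //.
  by move=> p [/aA|/bA].
- move=> p Ap; have [a [pa aA]] := nbhs_basic_set (open_nbhs_nbhs (conj oA Ap)).
  by exists (basic_set a); split=> //; [exists a|exact: open_basic_set].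
by exists a; apply/compact_clopen_eq/seteqP.
Qed.

End StoneSpace.

End PrimeFilters.

(** * The functor of compact clopen sets *)

Section PreimageMorphism.
Variables X Y : zlc.

Definition cc_preimage (f : X -> Y) (fp : perfect_map f)
    (B : compact_clopen Y) : compact_clopen X :=
  let: And3 fc _ _ := fp in
  CompactClopen (preimage_clopen (compact_clopen_clopen B) fc)
    (perfect_map_preimage_compact fp (@compact_clopen_compact _ B)).

Lemma cc_preimageE f (fp : perfect_map f) (B : compact_clopen Y) :
  cc_preimage fp B = f @^-1` B :> set X.
Proof. by rewrite /cc_preimage; case: fp. Qed.

(** Cofinality holds since the compact image of [B] lies in a compact clopen
    set. For meets, a lower bound [C] of the preimages that is not contained in
    [f @^-1` a] would yield, by quasi-openness, a nonempty compact clopen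
    [D `<=` f @` (C `\` f @^-1` a)]: a lower bound of the family that is
    disjoint from its meet [a]. *)
Lemma cc_preimage_qgbpl f (fp : perfect_map f) : quasi_open f ->
  @qgbpl_morphism (compact_clopen_gbpl Y) (compact_clopen_gbpl X)
    (cc_preimage fp).
Proof.
move=> fo; have [fc _ _] := fp.
split; first split; first split.
- by apply: compact_clopen_eq; rewrite cc_preimageE.
- by move=> A B; apply: compact_clopen_eq; rewrite /= !cc_preimageE.
- by move=> A B; apply: compact_clopen_eq; rewrite /= !cc_preimageE.
- move=> B; have kfB : compact (f @` B).
    apply: continuous_compact; last exact: compact_clopen_compact.
    exact: continuous_subspaceT.
  have [A fBA] := compact_sub_compact_clopen kfB; exists A.
  by apply/cc_leP; rewrite cc_preimageE => x Bx; apply: fBA; exists x.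
- move=> K s a [lb glb]; split=> [_ [k _ <-]|C lbC].
    apply/cc_leP => /=; rewrite !cc_preimageE; apply: preimage_subset.
    by apply/cc_leP/lb; exists k.
  apply/cc_leP; rewrite cc_preimageE => x Cx; apply: contrapT => nax.
  pose U := C `\` f @^-1` a.
  have oU : open U.
    have [+ _] := compact_clopen_clopen (ccD C (cc_preimage fp a)).
    by rewrite /= cc_preimageE.
  have [y fUy] := fo U oU (ex_intro _ x (conj Cx nax)).
  have [D [Dy DfU]] := compact_clopen_nbhs fUy.
  have [z [_ nafz] fzy] := DfU y Dy; apply: nafz.
  suff /cc_leP Da : (D <= a)%O by rewrite /preimage /= fzy; exact: Da.
  apply: glb => _ [k _ <-]; apply/cc_leP => w /DfU [v [Cv _] <-].
  have /cc_leP := lbC _ (imageT (cc_preimage fp \o s) k).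
  by rewrite /= cc_preimageE; apply.
Qed.

End PreimageMorphism.

Lemma concrete_hom_eq (T : Type) (P : T -> Prop) (f g : {x | P x}) :
  sval f = sval g -> f = g.
Proof. by case: f g => [f fP] [g gP]; exact: eq_exist. Qed.

Definition cc_hom (X Y : QPZLC) (f : hom X Y) :
  @hom (opposite QGBPL) (compact_clopen_gbpl X) (compact_clopen_gbpl Y) :=
  exist _ _ (cc_preimage_qgbpl (svalP f).1 (svalP f).2).

Lemma cc_hom1 (X : QPZLC) :
  cc_hom (idc X) = @idc (opposite QGBPL) (compact_clopen_gbpl X).
Proof.
apply: concrete_hom_eq; apply: funext => A; apply: compact_clopen_eq.
by rewrite cc_preimageE.
Qed.

Lemma cc_homM (X Y Z : QPZLC) (g : hom Y Z) (f : hom X Y) :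
  cc_hom (compc g f) = compc (cc_hom g) (cc_hom f).
Proof.
apply: concrete_hom_eq; apply: funext => A; apply: compact_clopen_eq.
by rewrite /= !cc_preimageE.
Qed.

Definition compact_clopen_functor : functor QPZLC (opposite QGBPL) :=
  @Functor QPZLC (opposite QGBPL) (fun X : zlc => compact_clopen_gbpl X)
    cc_hom cc_hom1 cc_homM.

(** * Faithfulness and fullness *)

Lemma cc_hom_faithful (X Y : QPZLC) (f g : hom X Y) :
  cc_hom f = cc_hom g -> f = g.
Proof.
move=> /(congr1 sval) /= fg; apply: concrete_hom_eq; apply: funext => x.
apply: contrapT => /eqP fgx.
have cl := @zlc_closed_set1 Y (sval g x).
have [|A [Afx Ag]] := @compact_clopen_nbhs Y (sval f x) (~` [set sval g x]).
  by apply: open_nbhs_nbhs; split; [exact: closed_openC|exact/eqP].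
have /(congr1 (@compact_clopen_set X)) := congr1 (@^~ A) fg.
rewrite !cc_preimageE => /predeqP /(_ x) [/(_ Afx) /Ag nfx _]; exact: nfx.
Qed.

(** The members of [p] have a common point, for otherwise their complements
    would form a directed open cover of some compact member [A0] of [p]. A
    compact clopen [A] through that point is in [p], since [p] contains [A] or
    [A0 `\` A], and the latter misses the point. *)
Lemma prime_filter_point (Y : zlc) (p : prime_filter (compact_clopen_gbpl Y)) :
  exists y : Y, forall A : compact_clopen Y, p A <-> A y.
Proof.
have [A0 pA0] := prime_filter_ex p.
suff [y yP] : exists y : Y, forall A : compact_clopen Y, p A -> A y.
  exists y => A; split=> [/yP//|Ay]; apply: contrapT => npA.
  have /yP[//] : p (ccD A0 A).
  have : p (ccU A (ccD A0 A)).
    apply: prime_filter_le pA0; apply/cc_leP => z A0z.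
    by have [Az|nAz] := pselect (A z); [left|right].
  by move=> /prime_filterU[].
apply: contrapT => noy.
have [||||U [A pA UA] A0U] := @compact_directed_cover _ A0
    [set U | exists2 A : compact_clopen Y, p A & U `<=` ~` A].
- exact: compact_clopen_compact.
- by exists A0.
- move=> U V [A pA UA] [B pB VB]; exists (ccI A B).
    by apply/prime_filterI.
  by move=> x [/UA nA|/VB nB] [].
- move=> x _; apply: contrapT => nx; apply: noy; exists x => A pA.
  apply: contrapT => nAx; apply: nx; exists (~` A).
  split=> //; first by exists A.
  by have [] := clopenC set0 (compact_clopen_clopen A).
have A0A : ccI A0 A = cc0 Y.
  by apply: compact_clopen_eq; apply/seteqP; split=> // x [/A0U /UA].
apply: (@prime_filter0 _ _ p); have : p (ccI A0 A) by apply/prime_filterI.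
by rewrite A0A.
Qed.

Section PointMap.
Local Open Scope order_scope.
Variables (X Y : zlc) (phi : compact_clopen_gbpl Y -> compact_clopen_gbpl X).
Hypothesis phiP : qgbpl_morphism phi.

Lemma point_prime_filter (x : X) :
  exists p : prime_filter (compact_clopen_gbpl Y),
    forall A, p A <-> (phi A : compact_clopen X) x.
Proof.
have [[[phi0 phiI phiU] phic] _] := phiP.
pose p (A : compact_clopen_gbpl Y) := (phi A : compact_clopen X) x.
have p0 : ~ p \bot by rewrite /p phi0.
have pI A B : p (A `&` B) <-> p A /\ p B by rewrite /p phiI.
have pU A B : p (A `|` B) <-> p A \/ p B by rewrite /p phiU.
have pE : exists A, p A.
  have [B [Bx _]] := compact_clopen_nbhs (@filterT _ (nbhs x) _).
  by have [A /cc_leP BA] := phic B; exists A; exact: BA.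
by exists (PrimeFilter p0 pI pU pE).
Qed.

Lemma point_map_exists : exists f : X -> Y,
  forall A : compact_clopen Y, f @^-1` A = phi A :> set X.
Proof.
have /choice [f fP] : forall x, exists y : Y,
    forall A : compact_clopen Y, A y <-> (phi A : compact_clopen X) x.
  move=> x; have [p pP] := point_prime_filter x.
  have [y yP] := prime_filter_point p; exists y => A.
  by rewrite -pP; symmetry.
by exists f => A; apply/predeqP => x; exact: fP.
Qed.

Variable f : X -> Y.
Hypothesis fP : forall A : compact_clopen Y, f @^-1` A = phi A :> set X.

Lemma point_map_continuous : continuous f.
Proof.
move=> x U /compact_clopen_nbhs [A [Afx AU]].
have [oA _] := compact_clopen_clopen (phi A : compact_clopen X).
apply: (@filterS _ (nbhs x) _ (phi A : compact_clopen X)).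
  by rewrite -fP => z /AU.
by apply: open_nbhs_nbhs; split=> //; rewrite -fP.
Qed.

Lemma point_map_image_compact (K : set X) : compact K -> compact (f @` K).
Proof.
apply: continuous_compact; apply: continuous_subspaceT.
exact: point_map_continuous.
Qed.

Lemma point_map_image_closed (K : set X) : compact K -> closed (f @` K).
Proof.
move=> /point_map_image_compact; apply: compact_closed.
exact: zlc_hausdorff.
Qed.

(** To see that [f @` C] is closed, it is enough to intersect it with a compact
    clopen neighbourhood [A] of the limit point: [f @` C `&` A] is the image of
    the compact set [C `&` f @^-1` A]. *)
Lemma point_map_perfect : perfect_map f.
Proof.
split; first exact: point_map_continuous.
- move=> C cC y yC.
  have [A [Ay _]] := compact_clopen_nbhs (@filterT _ (nbhs y) _).
  have kCA : compact (C `&` f @^-1` A)%classic.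
    rewrite setIC fP; apply: compact_closedI => //.
    exact: compact_clopen_compact.
  suff [x [Cx _] <-] : (f @` (C `&` f @^-1` A))%classic y by exists x.
  apply: (point_map_image_closed kCA) => V Vy.
  have [oA _] := compact_clopen_clopen A.
  have VA : nbhs y (V `&` A)%classic.
    by apply: filterI => //; apply: open_nbhs_nbhs.
  have [_ [[x Cx <-] [Vfx Afx]]] := yC _ VA.
  by exists (f x); split=> //; exists x.
- move=> y; have [A [Ay _]] := compact_clopen_nbhs (@filterT _ (nbhs y) _).
  apply: (@subclosed_compact _ _ (phi A : compact_clopen X)).
  + apply: (continuous_closedP _).1; first exact: point_map_continuous.
    exact: zlc_closed_set1.
  + exact: compact_clopen_compact.
  + by move=> x fxy; rewrite -fP; rewrite /preimage /= fxy; exact: Ay.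
Qed.

(** If [f @` U] had empty interior, so would [f @` B] for a nonempty compact
    clopen [B `<=` U]. The compact clopen sets containing the closed set
    [f @` B] intersect in [f @` B], so their meet in the lattice would be the
    empty set; but their images under [phi] all contain [B]. *)
Lemma point_map_quasi_open : quasi_open f.
Proof.
move=> U oU [x Ux].
have [B [Bx BU]] := compact_clopen_nbhs (open_nbhs_nbhs (conj oU Ux)).
have cfB := point_map_image_closed (@compact_clopen_compact _ B).
apply: contrapT => fU0.
have noD (D : compact_clopen Y) : D `<=` f @` B -> D = cc0 Y.
  move=> DB; apply: compact_clopen_eq; apply/seteqP; split=> // y Dy.
  apply: fU0; exists y; have [oD _] := compact_clopen_clopen D.
  apply: filterS (open_nbhs_nbhs (conj oD Dy)) => z /DB.
  exact: image_subset BU z.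
pose K := {A : compact_clopen_gbpl Y | f @` B `<=` (A : compact_clopen Y)}.
have inf0 : infimums (range (fun k : K => sval k)) \bot.
  split=> [A _|D Dlb]; first exact: le0x.
  suff -> : D = \bot by [].
  apply: noD => y Dy; apply: contrapT => nfBy.
  have [A [Ay AfB]] : exists A : compact_clopen Y, A y /\ A `<=` ~` (f @` B).
    apply/compact_clopen_nbhs/open_nbhs_nbhs; split=> //.
    exact: closed_openC.
  have [E fBE] := compact_sub_compact_clopen
    (point_map_image_compact (@compact_clopen_compact _ B)).
  have fBEA : f @` B `<=` ccD E A.
    by move=> z fBz; split=> [|/AfB//]; exact: fBE.
  pose k : K := exist _ (ccD E A : compact_clopen_gbpl Y) fBEA.
  have /cc_leP DEA := Dlb _ (imageT _ k).
  by have [] := DEA y Dy.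
have [[[phi0 _ _] _] /(_ _ _ _ inf0) [_ glb]] := phiP.
have /cc_leP BX : B <= \bot :> compact_clopen_gbpl X.
  rewrite -phi0; apply: glb => _ [[A fBA] _ <-]; apply/cc_leP => z Bz /=.
  by rewrite -fP; apply: fBA; exists z.
exact: BX Bx.
Qed.

End PointMap.

Lemma cc_hom_full (X Y : zlc)
    (g : @hom (opposite QGBPL) (compact_clopen_gbpl X)
      (compact_clopen_gbpl Y)) :
  exists f : @hom QPZLC X Y, cc_hom f = g.
Proof.
have [f fP] := point_map_exists (svalP g).
have fq : quasi_open_perfect f.
  split; first exact: point_map_perfect fP.
  exact: (point_map_quasi_open (svalP g) fP).
exists (exist _ f fq); apply: concrete_hom_eq; apply: funext => A.
by apply: compact_clopen_eq; rewrite cc_preimageE /= fP.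
Qed.

(** * Essential surjectivity *)

Section OrderIsomorphism.
Local Open Scope order_scope.
Variables (I J : gbpl) (f : I -> J) (g : J -> I).
Hypotheses (gK : cancel g f) (f_le : {mono f : a b / a <= b}).

Lemma le_iso_adjoint a b : (f a <= b) = (a <= g b).
Proof. by rewrite -[in LHS](gK b) f_le. Qed.

Lemma ge_iso_adjoint a b : (b <= f a) = (g b <= a).
Proof. by rewrite -[in LHS](gK b) f_le. Qed.

(** An order isomorphism is both a left and a right adjoint of its inverse, so
    it preserves all existing meets and joins. *)
Lemma order_iso_qgbpl : qgbpl_morphism f.
Proof.
split; first split; first split.
- by apply/eqP; rewrite -lex0 le_iso_adjoint le0x.
- move=> a b; apply/eqP; rewrite eq_le lexI !f_le leIl leIr /=.
  by rewrite ge_iso_adjoint lexI -!ge_iso_adjoint leIl leIr.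
- move=> a b; apply/eqP; rewrite eq_le leUx !f_le leUl leUr andbT.
  by rewrite le_iso_adjoint leUx -!le_iso_adjoint leUl leUr.
- by move=> b; exists (g b); rewrite gK.
- move=> K s a [lb glb]; split=> [_ [k _ <-]|c lbc] /=.
    by rewrite f_le; apply: lb; exists k.
  rewrite ge_iso_adjoint; apply: glb => _ [k _ <-].
  by rewrite -ge_iso_adjoint; apply: lbc; exists k.
Qed.

End OrderIsomorphism.

Lemma cc_functor_ess_surj (I : opposite QGBPL) :
  exists (X : QPZLC) (u : hom (compact_clopen_functor X) I)
    (v : hom I (compact_clopen_functor X)),
    compc v u = idc (compact_clopen_functor X) /\ compc u v = idc I.
Proof.
have /choice [g gP] := @stone_map_surj I.
have sK : cancel (@stone_map I : _ -> compact_clopen_gbpl _) g.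
  move=> a; apply/eqP; rewrite eq_le.
  by rewrite -!stone_map_le !gP lexx.
have smono : {mono (@stone_map I : _ -> compact_clopen_gbpl (stone_space I)) :
    a b / (a <= b)%O} := @stone_map_le I.
have gmono : {mono g : a b / (a <= b)%O}.
  by move=> A B; rewrite -stone_map_le !gP.
pose J := compact_clopen_gbpl (stone_space I).
have sq := @order_iso_qgbpl I J _ g gP smono.
have gq := @order_iso_qgbpl J I g _ sK gmono.
exists (stone_space I), (exist _ _ sq), (exist _ _ gq).
by split; apply: concrete_hom_eq; apply: funext => a /=; rewrite ?gP ?sK.
Qed.

Theorem theorem2p6 : dually_equivalent QPZLC QGBPL.
Proof.
apply: (@equivalent_fully_faithful _ _ compact_clopen_functor).
- exact: cc_hom_faithful.
- exact: cc_hom_full.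
- exact: cc_functor_ess_surj.
Qed.
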